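(* For all rational numbers $m_1,m_2$, define $$\begin{aligned} x_1&=56m_1^2m_2+60m_1m_2^2+12m_2^3+44m_1^2+70m_1m_2+24m_2^2+10m_1+9m_2,\\ x_2&=-24m_1^2m_2+12m_2^3-36m_1^2-40m_1m_2-6m_2^2-10m_1-6m_2,\\ x_3&=56m_1^2m_2+80m_1m_2^2+32m_2^3-16m_1^2+20m_1m_2+24m_2^2+4m_2,\\ x_4&=-64m_1^2m_2-80m_1m_2^2-28m_2^3-16m_1^2-60m_1m_2-36m_2^2-10m_1-11m_2,\\ x_5&=-24m_1^2m_2-60m_1m_2^2-28m_2^3+24m_1^2+10m_1m_2-6m_2^2+10m_1+4m_2,\\ y_1&=-24m_1^2m_2+12m_2^3+24m_1^2+40m_1m_2+24m_2^2+10m_1+9m_2,\\ y_2&=56m_1^2m_2+60m_1m_2^2+12m_2^3-16m_1^2-10m_1m_2-6m_2^2-10m_1-6m_2,\\ y_3&=-64m_1^2m_2-80m_1m_2^2-28m_2^3-16m_1^2-20m_1m_2-6m_2^2+4m_2,\\ y_4&=56m_1^2m_2+80m_1m_2^2+32m_2^3+44m_1^2+60m_1m_2+24m_2^2+10m_1+4m_2,\\ y_5&=-24m_1^2m_2-60m_1m_2^2-28m_2^3-36m_1^2-70m_1m_2-36m_2^2-10m_1-11m_2. \end{aligned}$$ Then $\sum_{i=1}^5x_i=\sum_{i=1}^5y_i=0$ and $$\sum_{i=1}^5x_i^r=\sum_{i=1}^5y_i^r\qquad\text{for } r=1,2,3,4,6.$$ Moreover, as a parametric solution this is nontrivial and nonsymmetric: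 in $\mathbb{Q}[m_1,m_2]$ the multiset $\{y_1,\dots,y_5\}$ is equal neither to the multiset $\{x_1,\dots,x_5\}$ nor to the multiset $\{-x_1,\dots,-x_5\}$.
   Context: An ideal solution of the Tarry-Escott problem of degree $k$ consists of two distinct multisets $\{x_1,\dots,x_{k+1}\}$, $\{y_1,\dots,y_{k+1}\}$ with $\sum x_i^r=\sum y_i^r$ for $r=1,\dots,k$. For $k=4$, a solution with $\sum x_i=\sum y_i=0$ is symmetric if, after rearrangement, $x_i=-y_i$ for all $i$, and nonsymmetric otherwise. *)

(* Defs.v *)
From mathcomp Require Import all_boot all_order all_algebra.

Set Implicit Arguments.
Unset Strict Implicit.
Unset Printing Implicit Defensive.

Import GRing.Theory.
Local Open Scope ring_scope.

(* The formulas are stated over an arbitrary commutative ring so that the same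
   definition gives both the values at rational m1, m2 (R := rat) and the
   elements of Q[m1, m2] (R := {mpoly rat[2]}, with the two indeterminates). *)
Definition xfam (R : comNzRingType) (m1 m2 : R) : 5.-tuple R :=
  [tuple
     56 * m1 ^+ 2 * m2 + 60 * m1 * m2 ^+ 2 + 12 * m2 ^+ 3 + 44 * m1 ^+ 2
      + 70 * m1 * m2 + 24 * m2 ^+ 2 + 10 * m1 + 9 * m2;
     - 24 * m1 ^+ 2 * m2 + 12 * m2 ^+ 3 - 36 * m1 ^+ 2 - 40 * m1 * m2
      - 6 * m2 ^+ 2 - 10 * m1 - 6 * m2;
     56 * m1 ^+ 2 * m2 + 80 * m1 * m2 ^+ 2 + 32 * m2 ^+ 3 - 16 * m1 ^+ 2
      + 20 * m1 * m2 + 24 * m2 ^+ 2 + 4 * m2;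
     - 64 * m1 ^+ 2 * m2 - 80 * m1 * m2 ^+ 2 - 28 * m2 ^+ 3 - 16 * m1 ^+ 2
      - 60 * m1 * m2 - 36 * m2 ^+ 2 - 10 * m1 - 11 * m2;
     - 24 * m1 ^+ 2 * m2 - 60 * m1 * m2 ^+ 2 - 28 * m2 ^+ 3 + 24 * m1 ^+ 2
      + 10 * m1 * m2 - 6 * m2 ^+ 2 + 10 * m1 + 4 * m2].

Definition yfam (R : comNzRingType) (m1 m2 : R) : 5.-tuple R :=
  [tuple
     - 24 * m1 ^+ 2 * m2 + 12 * m2 ^+ 3 + 24 * m1 ^+ 2 + 40 * m1 * m2
      + 24 * m2 ^+ 2 + 10 * m1 + 9 * m2;
     56 * m1 ^+ 2 * m2 + 60 * m1 * m2 ^+ 2 + 12 * m2 ^+ 3 - 16 * m1 ^+ 2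
      - 10 * m1 * m2 - 6 * m2 ^+ 2 - 10 * m1 - 6 * m2;
     - 64 * m1 ^+ 2 * m2 - 80 * m1 * m2 ^+ 2 - 28 * m2 ^+ 3 - 16 * m1 ^+ 2
      - 20 * m1 * m2 - 6 * m2 ^+ 2 + 4 * m2;
     56 * m1 ^+ 2 * m2 + 80 * m1 * m2 ^+ 2 + 32 * m2 ^+ 3 + 44 * m1 ^+ 2
      + 60 * m1 * m2 + 24 * m2 ^+ 2 + 10 * m1 + 4 * m2;
     - 24 * m1 ^+ 2 * m2 - 60 * m1 * m2 ^+ 2 - 28 * m2 ^+ 3 - 36 * m1 ^+ 2
      - 70 * m1 * m2 - 36 * m2 ^+ 2 - 10 * m1 - 11 * m2].

(* Main.v *)
(** The power sum identities are polynomial identities in [m1] and [m2], valid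
    over every commutative ring.  For the second part, specialising at
    [m1 = m2 = 1] already separates the multisets: the [y_i] take the value 95
    there, while neither 95 nor -95 is among 285, -110, 200, -305, -70, the
    values of the [x_i]. *)

Require Import Defs.
From mathcomp Require Import all_boot all_order all_algebra.
From mathcomp.multinomials Require Import mpoly.
From mathcomp Require Import ring.
Import GRing.Theory.
Local Open Scope ring_scope.

Lemma sum_xfam (R : comNzRingType) (m1 m2 : R) :
  \sum_(i < 5) tnth (xfam m1 m2) i = 0.
Proof.
rewrite -(big_tuple _ _ _ predT id) /= !(big_cons, big_nil); ring.
Qed.

Lemma sum_yfam (R : comNzRingType) (m1 m2 : R) :
  \sum_(i < 5) tnth (yfam m1 m2) i = 0.
Proof.
rewrite -(big_tuple _ _ _ predT id) /= !(big_cons, big_nil); ring.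
Qed.

Lemma power_sum_xfam_yfam (R : comNzRingType) (m1 m2 : R) (r : nat) :
  r \in [:: 1; 2; 3; 4; 6]%N ->
  \sum_(i < 5) tnth (xfam m1 m2) i ^+ r =
  \sum_(i < 5) tnth (yfam m1 m2) i ^+ r.
Proof.
rewrite -!(big_tuple _ _ _ predT (fun a => a ^+ r)) /= !(big_cons, big_nil).
(* Splitting the membership turns [r] into a numeral, so each case is a single polynomial
   identity. *)
rewrite !inE; do 4?[case/orP=> [/eqP->|]; first by ring].
by move/eqP->; ring.
Qed.

(** Each entry is a polynomial in [m1], [m2] with integer coefficients, and ring morphisms preserve
    these. This lets evaluation act on the parameters alone. *)
Lemma map_xfam (R S : comNzRingType) (f : {rmorphism R -> S}) (m1 m2 : R) :
  map f (xfam m1 m2) = xfam (f m1) (f m2).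
Proof. by do 5?[congr (_ :: _); first by ring]. Qed.

Lemma map_yfam (R S : comNzRingType) (f : {rmorphism R -> S}) (m1 m2 : R) :
  map f (yfam m1 m2) = yfam (f m1) (f m2).
Proof. by do 5?[congr (_ :: _); first by ring]. Qed.

Theorem mainTheorem1 :
  (forall m1 m2 : rat,
     [/\ \sum_(i < 5) tnth (xfam m1 m2) i = 0,
         \sum_(i < 5) tnth (yfam m1 m2) i = 0
       & forall r : nat, r \in [:: 1; 2; 3; 4; 6]%N ->
           \sum_(i < 5) tnth (xfam m1 m2) i ^+ r =
           \sum_(i < 5) tnth (yfam m1 m2) i ^+ r])
  /\ (let m1 : {mpoly rat[2]} := 'X_ord0 in
      let m2 : {mpoly rat[2]} := 'X_ord_max in
      ~~ perm_eq (yfam m1 m2) (xfam m1 m2)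
      /\ ~~ perm_eq (yfam m1 m2) [seq - a | a <- xfam m1 m2]).
Proof.
split=> [m1 m2|m1 m2].
  by split=> [||r]; [exact: sum_xfam | exact: sum_yfam
                    | exact: power_sum_xfam_yfam].
(* The constant valuation sends both indeterminates to 1 and carries a permutation of polynomials to
   one of rationals. *)
pose ev : {rmorphism {mpoly rat[2]} -> rat} := meval (fun=> 1).
have ev_x : map ev (xfam m1 m2) = xfam (1 : rat) 1.
  by rewrite map_xfam /= !mevalXU.
have ev_y : map ev (yfam m1 m2) = yfam (1 : rat) 1.
  by rewrite map_yfam /= !mevalXU.
have ev_Nx : map ev [seq - a | a <- xfam m1 m2] =
             [seq - a | a <- xfam (1 : rat) 1].
  by rewrite -ev_x -!map_comp; apply: eq_map => a /=; rewrite rmorphN.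
split; apply/negP => /(perm_map ev).
  (* Permuted lists have the same members, but the two memberships of 95 compute to [true] and
     [false]. *)
  by rewrite ev_x ev_y => /perm_mem/(_ 95); vm_compute.
by rewrite ev_Nx ev_y => /perm_mem/(_ 95); vm_compute.
Qed.
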